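(* Let $H\colon T^*\mathbb{R}^d\to\mathbb{R}$ be smooth, let $\hat\Phi$ be an integrator for the extended Hamiltonian system (see context), and assume that for each $\Delta t$ the map $\hat\Phi_{\Delta t}\colon T^*\mathbb{R}^{2d}\to T^*\mathbb{R}^{2d}$ is symplectic, i.e. $\hat\Phi_{\Delta t}^*\hat\Omega=\hat\Omega$ with $\hat\Omega=\mathbf{d}q\wedge\mathbf{d}p+\mathbf{d}x\wedge\mathbf{d}y$. Let $\Phi_{\Delta t}\colon U\to T^*\mathbb{R}^d$, $\Delta t\in(-\varepsilon,\varepsilon)$, be the extended phase space integrator with symmetric projection associated with $\hat\Phi$ (see context). Then $\Phi_{\Delta t}$ is symplectic on the original phase space: $$\Phi_{\Delta t}^*\,\Omega=\Omega,\qquad \Omega=\mathbf{d}q\wedge\mathbf{d}p .$$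
   Context: Notation. $d\ge 1$; $T^*\mathbb{R}^d\cong\mathbb{R}^{2d}$ has coordinates $z=(q,p)$, and $T^*\mathbb{R}^{2d}\cong\mathbb{R}^{4d}$ has coordinates $\zeta=(q,x,p,y)$ with $q,x,p,y\in\mathbb{R}^d$. For $\mathbb{R}^d$-valued quantities, $\mathbf{d}a\wedge\mathbf{d}b$ means $\sum_{i=1}^d\mathbf{d}a_i\wedge\mathbf{d}b_i$. $D_i$ denotes the partial derivative with respect to the $i$-th set of variables. Extended Hamiltonian system on $T^*\mathbb{R}^{2d}$ for a smooth $H\colon T^*\mathbb{R}^d\to\mathbb{R}$: $\dot q=D_2H(x,p)$, $\dot x=D_2H(q,y)$, $\dot p=-D_1H(q,y)$, $\dot y=-D_1H(x,p)$. Write $\hat X$ for its vector field. An integrator for it is a smooth map $\mathbb{R}\times T^*\mathbb{R}^{2d}\to T^*\mathbb{R}^{2d}$, $(h,\zeta)\mapsto\hat\Phi_h(\zeta)$, with $\hat\Phi_0=\mathrm{id}$ and $\frac{\partial}{\partial h}\hat\Phi_h(\zeta)|_{h=0}=\hat X(\zeta)$. Let $\iota\colon T^*\mathbb{R}^d\to T^*\mathbb{R}^{2d}$, $\iota(q,p)=(q,q,p,p)$, and let $A\colon\mathbb{R}^{4d}\to\mathbb{R}^{2d}$ be the linear map $A(q,x,p,y)=(q-x,p-y)$, so that $A^T(\mu_1,\mu_2)=(\mu_1,-\mu_1,\mu_2,-\mu_2)$ and $\ker A=\mathcal{N}:=\{(q,q,p,p)\}=\iota(T^*\mathbb{R}^d)$.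 Extended phase space integrator with symmetric projection: $U\subset T^*\mathbb{R}^d$ is open, $\varepsilon>0$, $V\subset\mathbb{R}^{2d}$ is an open ball centered at $0$, and $\mu\colon(-\varepsilon,\varepsilon)\times U\to V$, $(\Delta t,z)\mapsto\mu_{\Delta t}(z)$, and $\Phi\colon(-\varepsilon,\varepsilon)\times U\to T^*\mathbb{R}^d$, $(\Delta t,z)\mapsto\Phi_{\Delta t}(z)$, are smooth maps such that for every $(\Delta t,z)\in(-\varepsilon,\varepsilon)\times U$, $\lambda=\mu_{\Delta t}(z)$ is the unique $\lambda\in V$ with $\hat\Phi_{\Delta t}(\iota(z)+A^T\lambda)+A^T\lambda\in\mathcal{N}$, and $$\iota(\Phi_{\Delta t}(z))=\hat\Phi_{\Delta t}\bigl(\iota(z)+A^T\mu_{\Delta t}(z)\bigr)+A^T\mu_{\Delta t}(z).$$ (By the implicit function theorem such data exist near any point of $T^*\mathbb{R}^d$.) *)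

(* Defs.v *)
From HB Require Import structures.
From mathcomp Require Import all_boot all_order all_algebra.
From mathcomp Require Import all_classical all_reals all_analysis.

Set Implicit Arguments.
Unset Strict Implicit.
Unset Printing Implicit Defensive.

Import Order.TTheory GRing.Theory Num.Theory.
Import numFieldNormedType.Exports.

Local Open Scope classical_set_scope.
Local Open Scope ring_scope.

(* [phase R d] has coordinates (q, p); [ext_phase R d] has coordinates
   (q, x, p, y), that is (((q, x), p), y). *)
Notation phase R d := ('rV[R]_d * 'rV[R]_d)%type.
Notation ext_phase R d := ('rV[R]_d * 'rV[R]_d * 'rV[R]_d * 'rV[R]_d)%type.

(* Class C^k and C^oo on a set [D], which is meant to be open.  A smooth map on
   an open subset is represented by a total function whose values outside the
   subset play no role, since 'd f x depends only on the germ of f at x. *)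
Fixpoint class_C (R : realType) (V W : normedModType R) (k : nat)
    (D : set V) (f : V -> W) : Prop :=
  match k with
  | 0%N => forall x, D x -> {for x, continuous f}
  | k'.+1 => (forall x, D x -> differentiable f x) /\
             (forall v, class_C k' D (fun x => 'd f x v))
  end.

Definition smooth_on (R : realType) (V W : normedModType R)
    (D : set V) (f : V -> W) : Prop :=
  forall k, class_C k D f.

Section Forms.
Variable R : realType.

(* A differential 2-form on V assigns to each point a function of two tangent
   vectors. *)
Definition form2 (V : normedModType R) := V -> V -> V -> R.

Definition wedge (V : normedModType R) (a b : V -> R) (u v : V) : R :=
  a u * b v - a v * b u.

Definition pullback (V W : normedModType R) (f : V -> W) (omega : form2 W) :
    form2 V :=
  fun z u v => omega (f z) ('d f z u) ('d f z v).

Definition preserves_on (V : normedModType R) (D : set V) (f : V -> V)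
    (omega : form2 V) : Prop :=
  forall z, D z -> forall u v, pullback f omega z u v = omega z u v.

Variable d : nat.

Definition Omega : form2 (phase R d) := fun z u v =>
  \sum_(i < d) wedge ('d (fun w : phase R d => w.1 0 i) z)
                     ('d (fun w : phase R d => w.2 0 i) z) u v.

Definition ext_q (zeta : ext_phase R d) : 'rV[R]_d := zeta.1.1.1.
Definition ext_x (zeta : ext_phase R d) : 'rV[R]_d := zeta.1.1.2.
Definition ext_p (zeta : ext_phase R d) : 'rV[R]_d := zeta.1.2.
Definition ext_y (zeta : ext_phase R d) : 'rV[R]_d := zeta.2.

Definition ext_Omega : form2 (ext_phase R d) := fun zeta u v =>
  \sum_(i < d) wedge ('d (fun w => ext_q w 0 i) zeta)
                     ('d (fun w => ext_p w 0 i) zeta) u v +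
  \sum_(i < d) wedge ('d (fun w => ext_x w 0 i) zeta)
                     ('d (fun w => ext_y w 0 i) zeta) u v.

End Forms.

Arguments Omega {R d}.
Arguments ext_Omega {R d}.

Section ExtendedSystem.
Variables (R : realType) (d : nat).

(* D_1 H and D_2 H, as vectors of partial derivatives. *)
Definition D1 (H : phase R d -> R) (z : phase R d) : 'rV[R]_d :=
  \row_(i < d) 'D_(delta_mx 0 i, 0) H z.
Definition D2 (H : phase R d -> R) (z : phase R d) : 'rV[R]_d :=
  \row_(i < d) 'D_(0, delta_mx 0 i) H z.

Definition ext_field (H : phase R d -> R) (zeta : ext_phase R d) :
    ext_phase R d :=
  let: (q, x, p, y) := zeta in
  (D2 H (x, p), D2 H (q, y), - D1 H (q, y), - D1 H (x, p)).

Definition is_integrator (H : phase R d -> R)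
    (Phih : R -> ext_phase R d -> ext_phase R d) : Prop :=
  [/\ smooth_on setT (fun w : R * ext_phase R d => Phih w.1 w.2),
      forall zeta, Phih 0 zeta = zeta
    & forall zeta, derive1 (fun h => Phih h zeta) 0 = ext_field H zeta].

Definition iota_ext (z : phase R d) : ext_phase R d := (z.1, z.1, z.2, z.2).

Definition A_ext (zeta : ext_phase R d) : phase R d :=
  (ext_q zeta - ext_x zeta, ext_p zeta - ext_y zeta).

(* The transpose of [A_ext]. *)
Definition AT_ext (mu : phase R d) : ext_phase R d :=
  (mu.1, - mu.1, mu.2, - mu.2).

Definition N_ext : set (ext_phase R d) := range iota_ext.

Lemma ker_A_ext (zeta : ext_phase R d) : N_ext zeta <-> A_ext zeta = 0.
Proof.
case: zeta => [[[q x] p] y]; rewrite /A_ext /ext_q /ext_x /ext_p /ext_y /=; split.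
  by move=> [z _ [<- <- <- <-]]; rewrite !subrr.
move=> [] /eqP; rewrite subr_eq0 => /eqP <- /eqP.
by rewrite subr_eq0 => /eqP <-; exists (q, p).
Qed.

(* The product norm on [phase R d] is a sup norm, so Euclidean balls are
   written out. *)
Definition euclidean_ball (r : R) : set (phase R d) :=
  [set mu : phase R d |
    Num.sqrt (\sum_(i < d) mu.1 0 i ^+ 2 + \sum_(i < d) mu.2 0 i ^+ 2) < r].

Definition time_dom (eps : R) (U : set (phase R d)) : set (R * phase R d) :=
  [set w | - eps < w.1 < eps /\ U w.2].

(* [Phi], with multiplier [mu], is the integrator with symmetric projection
   associated with [Phih] on the parameter domain (-eps, eps) x U, with
   V = euclidean_ball r. *)
Definition symmetric_projection (Phih : R -> ext_phase R d -> ext_phase R d)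
    (U : set (phase R d)) (eps r : R)
    (mu Phi : R -> phase R d -> phase R d) : Prop :=
  [/\ smooth_on (time_dom eps U) (fun w : R * phase R d => mu w.1 w.2),
      smooth_on (time_dom eps U) (fun w : R * phase R d => Phi w.1 w.2),
      forall dt z, - eps < dt < eps -> U z ->
        unique (fun lam => euclidean_ball r lam /\
                  N_ext (Phih dt (iota_ext z + AT_ext lam) + AT_ext lam))
               (mu dt z)
    & forall dt z, - eps < dt < eps -> U z ->
        iota_ext (Phi dt z) =
        Phih dt (iota_ext z + AT_ext (mu dt z)) + AT_ext (mu dt z)].

End ExtendedSystem.

(* Main.v *)
(** Write m and n for the derivatives of mu at z along u and v, and w_u, w_v for
    those of Phi.  Differentiating the defining identity of the projection shows
    that the derivative of Phih sends iota u + A^T m to iota w_u - A^T m.  Since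
    the images of iota and A^T are orthogonal for ext_Omega, which pulls back to
    2 Omega along both maps, invariance of ext_Omega reads
    2 Omega(u, v) + 2 Omega(m, n) = 2 Omega(w_u, w_v) + 2 Omega(-m, -n), and the
    multiplier terms cancel. *)

Require Import Defs.
From HB Require Import structures.
From mathcomp Require Import all_boot all_order all_algebra.
From mathcomp Require Import all_classical all_reals all_analysis.
From mathcomp Require Import ring.

Set Implicit Arguments.
Unset Strict Implicit.
Unset Printing Implicit Defensive.

Import Order.TTheory GRing.Theory Num.Theory.
Import numFieldNormedType.Exports.

Local Open Scope classical_set_scope.
Local Open Scope ring_scope.

Section Differentials.
Variables (R : realType).
Implicit Types V W : normedModType R.

(** A continuous linear map is its own differential. Linearity is taken as a proposition and bundled
    with [f] inside the proof, so the result applies to plain functions such as [iota_ext] and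
    [AT_ext]. *)
Lemma is_diff_linear V W (f : V -> W) (x : V) :
  linear f -> continuous f -> is_diff x f f.
Proof.
move=> lf cf.
pose fL := HB.pack_for {linear V -> W} f (@GRing.isLinear.Build R V W *:%R f lf).
apply: (@DiffDef _ _ _ _ _ f).
  exact: (@linear_differentiable R V W fL x cf).
exact: (@diff_lin R V W fL x cf).
Qed.

(** Differentials are read off from directional derivatives, which depend only on the germ at [x].
    This allows an identity valid only near a point to be differentiated. *)
Lemma near_eq_is_diff V W (f g df dg : V -> W) (x : V) :
  is_diff x f df -> is_diff x g dg -> (\near x, f x = g x) -> df =1 dg.
Proof.
move=> [dfx <-] [dgx <-] fg u.
by rewrite -!deriveE//; apply: near_eq_derive.
Qed.

Lemma continuous_pair (T : topologicalType) V W (f : T -> V) (g : T -> W) :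
  continuous f -> continuous g -> continuous (fun t => (f t, g t)).
Proof. by move=> cf cg t; apply: cvg_pair; [exact: cf|exact: cg]. Qed.

Lemma continuous_fst V W : continuous (@fst V W).
Proof. by move=> t; exact: cvg_fst. Qed.

Lemma continuous_snd V W : continuous (@snd V W).
Proof. by move=> t; exact: cvg_snd. Qed.

(** Freezing the time is composition of the joint map with the affine map [y |-> (t, y)]. *)
Lemma differentiable_slice V W (F : R -> V -> W) (D : set (R * V)) (t : R)
    (z : V) :
  smooth_on D (fun w : R * V => F w.1 w.2) -> D (t, z) ->
  differentiable (F t) z.
Proof.
move=> sF Dtz; have [dF _] := sF 1%N.
have dp : differentiable (fun y : V => (t, y)) z.
  by apply: differentiable_pair => //; exact: ex_diff.
pose G (w : R * V) := F w.1 w.2.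
exact: (@differentiable_comp _ _ _ _ _ G z dp (dF _ Dtz)).
Qed.

End Differentials.

Section Forms.
Variables (R : realType) (d : nat).
Implicit Types (z u v m n : phase R d) (zeta : ext_phase R d).

Lemma diff_coord (V : normedModType R) (f : V -> 'rV[R]_d) (i : 'I_d) (x : V) :
  linear f -> continuous f ->
  'd (fun w => f w 0 i) x = (fun w => f w 0 i) :> (V -> R).
Proof.
move=> lf cf.
suff df : is_diff x (fun w => f w 0 i) (fun w => f w 0 i) by exact: diff_val.
apply: is_diff_linear; first by move=> k y w; rewrite lf !mxE.
move=> y; apply: (@continuous_comp _ _ _ f (fun N : 'rV_d => N 0 i)).
  exact: cf.
exact: coord_continuous.
Qed.

(** The form has constant coefficients: the base point drops out, so it can be set to [0] below. *)
Lemma OmegaE z u v :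
  Omega z u v = \sum_(i < d) (u.1 0 i * v.2 0 i - v.1 0 i * u.2 0 i).
Proof.
apply: eq_bigr => i _; rewrite /wedge !diff_coord //.
- exact: continuous_snd.
- exact: continuous_fst.
Qed.

Lemma ext_OmegaE zeta (u v : ext_phase R d) :
  ext_Omega zeta u v =
  Omega 0 (ext_q u, ext_p u) (ext_q v, ext_p v) +
  Omega 0 (ext_x u, ext_y u) (ext_x v, ext_y v).
Proof.
have cy : continuous (@ext_y R d) by exact: continuous_snd.
have c1 : continuous (fun w : ext_phase R d => w.1) by exact: continuous_fst.
have cp : continuous (@ext_p R d).
  move=> w; apply: (@continuous_comp _ _ _ (fun w : ext_phase R d => w.1) snd).
    exact: c1.
  exact: continuous_snd.
have c2 : continuous (fun w : ext_phase R d => w.1.1).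
  move=> w; apply: (@continuous_comp _ _ _ (fun w : ext_phase R d => w.1) fst).
    exact: c1.
  exact: continuous_fst.
have cx : continuous (@ext_x R d).
  move=> w; apply: (@continuous_comp _ _ _ (fun w : ext_phase R d => w.1.1) snd).
    exact: c2.
  exact: continuous_snd.
have cq : continuous (@ext_q R d).
  move=> w; apply: (@continuous_comp _ _ _ (fun w : ext_phase R d => w.1.1) fst).
    exact: c2.
  exact: continuous_fst.
have lq : linear (@ext_q R d) by [].
have lx : linear (@ext_x R d) by [].
have lp : linear (@ext_p R d) by [].
have ly : linear (@ext_y R d) by [].
rewrite !OmegaE; congr (_ + _); apply: eq_bigr => i _; rewrite /wedge.
  by rewrite (diff_coord i zeta lq cq) (diff_coord i zeta lp cp).
by rewrite (diff_coord i zeta lx cx) (diff_coord i zeta ly cy).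
Qed.

Lemma iota_ext_linear : linear (@iota_ext R d).
Proof. by []. Qed.

Lemma AT_ext_linear : linear (@AT_ext R d).
Proof. by move=> k x y; rewrite /AT_ext /= !opprD -!scalerN. Qed.

Lemma iota_ext_continuous : continuous (@iota_ext R d).
Proof.
have c1 : continuous (fun m : phase R d => m.1) by exact: continuous_fst.
have c2 : continuous (fun m : phase R d => m.2) by exact: continuous_snd.
exact: continuous_pair (continuous_pair (continuous_pair c1 c1) c2) c2.
Qed.

Lemma AT_ext_continuous : continuous (@AT_ext R d).
Proof.
have c1 : continuous (fun m : phase R d => m.1) by exact: continuous_fst.
have c2 : continuous (fun m : phase R d => m.2) by exact: continuous_snd.
have c1N : continuous (fun m : phase R d => - m.1).
  by move=> m; apply: cvgN; exact: c1.
have c2N : continuous (fun m : phase R d => - m.2).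
  by move=> m; apply: cvgN; exact: c2.
exact: continuous_pair (continuous_pair (continuous_pair c1 c1N) c2) c2N.
Qed.

(** The (q, p) components are [u + m] and [v + n], the (x, y) components [u - m] and [v - n]. In the
    sum of the two copies of [Omega] the mixed terms cancel and the others double. *)
Lemma ext_Omega_iotaDAT zeta u v m n :
  ext_Omega zeta (iota_ext u + AT_ext m) (iota_ext v + AT_ext n) =
  (Omega 0 u v + Omega 0 m n) *+ 2.
Proof.
rewrite ext_OmegaE !OmegaE -!big_split/= -sumrMnl; apply: eq_bigr => i _.
by rewrite !mxE mulr2n; ring.
Qed.

End Forms.

Theorem theorem5 (R : realType) (d : nat) (d_ge1 : (1 <= d)%N)
    (H : phase R d -> R) (smoothH : smooth_on setT H)
    (Phih : R -> ext_phase R d -> ext_phase R d)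
    (integratorPhih : is_integrator H Phih)
    (symplecticPhih : forall dt : R, preserves_on setT (Phih dt) ext_Omega)
    (U : set (phase R d)) (openU : open U)
    (eps : R) (eps_gt0 : 0 < eps) (r : R) (r_gt0 : 0 < r)
    (mu Phi : R -> phase R d -> phase R d)
    (projPhi : symmetric_projection Phih U eps r mu Phi) :
  forall dt : R, - eps < dt < eps -> preserves_on U (Phi dt) Omega.
Proof.
move=> dt dt_eps z Uz u v; rewrite /pullback.
have [smu sPhi _ iotaPhi] := projPhi.
have [sPhih _ _] := integratorPhih.
pose L : phase R d -> ext_phase R d := fun w => iota_ext w + AT_ext (mu dt w).
have dmu : is_diff z (mu dt) ('d (mu dt) z).
  by apply/differentiableP; apply: (differentiable_slice smu).
have dPhi : is_diff z (Phi dt) ('d (Phi dt) z).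
  by apply/differentiableP; apply: (differentiable_slice sPhi).
have dPhih : is_diff (L z) (Phih dt) ('d (Phih dt) (L z)).
  by apply/differentiableP; apply: (differentiable_slice sPhih).
have diota y : is_diff y (@iota_ext R d) (@iota_ext R d).
  exact: is_diff_linear (@iota_ext_linear R d) (@iota_ext_continuous R d).
have dAT y : is_diff y (@AT_ext R d) (@AT_ext R d).
  exact: is_diff_linear (@AT_ext_linear R d) (@AT_ext_continuous R d).
have dATmu : is_diff z (@AT_ext R d \o mu dt) (@AT_ext R d \o 'd (mu dt) z).
  exact: is_diff_comp.
have dL : is_diff z L (@iota_ext R d + (@AT_ext R d \o 'd (mu dt) z)).
  exact: is_diffD.
have dl : is_diff z (@iota_ext R d \o Phi dt) (@iota_ext R d \o 'd (Phi dt) z).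
  exact: is_diff_comp.
have dPhihL := is_diff_comp dL dPhih.
have dr := is_diffD dPhihL dATmu.
(* The defining identity is known on [U] only; openness of [U] makes it hold near [z]. *)
have near_iotaPhi : \forall y \near z, (@iota_ext R d \o Phi dt) y =
    ((Phih dt \o L) + (@AT_ext R d \o mu dt)) y.
  by have := open_nbhs_nbhs (conj openU Uz); apply: filterS => y; exact: iotaPhi.
have PhihLE w :
    'd (Phih dt) (L z) (iota_ext w + AT_ext ('d (mu dt) z w)) =
    iota_ext ('d (Phi dt) z w) + AT_ext (- 'd (mu dt) z w).
  have dlr : iota_ext ('d (Phi dt) z w) =
      'd (Phih dt) (L z) (iota_ext w + AT_ext ('d (mu dt) z w)) +
      AT_ext ('d (mu dt) z w).
    exact: near_eq_is_diff dl dr near_iotaPhi w.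
  rewrite dlr -[LHS](addrK (AT_ext ('d (mu dt) z w))).
  (* [AT_ext (- m)] and [- AT_ext m] agree by computation. *)
  by congr (_ + _).
have := symplecticPhih dt (L z) I
  (iota_ext u + AT_ext ('d (mu dt) z u)) (iota_ext v + AT_ext ('d (mu dt) z v)).
rewrite /pullback !PhihLE !ext_Omega_iotaDAT.
(* By bilinearity the two signs cancel, so the same multiplier term stands on both sides. *)
have OmegaN a b : Omega 0 (- a) (- b) = Omega (R := R) (d := d) 0 a b.
  by rewrite !OmegaE; apply: eq_bigr => i _; rewrite !mxE; ring.
(* The factor 2 can be divided out in [R], after which the common multiplier term is cancelled. *)
rewrite OmegaN => /eqP; rewrite -subr_eq0 -mulrnBl mulrn_eq0/= subr_eq0.
by move=> /eqP /addIr; rewrite !OmegaE.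
Qed.
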